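(* Let $p$ be a prime, $d\ge 1$, and let $f\in\mathbb{Z}[\mathbb{Z}^d]=\mathbb{Z}[t_1^{\pm1},\dots,t_d^{\pm1}]$ be a Laurent polynomial which does not vanish at any point of the $p$-adic $d$-torus $T_p^d$. Then for every sequence $\Gamma_n\to 0$ of subgroups of $\Gamma=\mathbb{Z}^d$ the $p$-adic entropy $h_p(f)$ of the $\mathbb{Z}^d$-action on $X_f$ exists, and \[ h_p(f)=m_p(f):=\int_{T_p^d}\log_p f(z), \] where the right-hand side is the Snirelman integral.
   Context: Let $\mathbb{C}_p$ be the completion of an algebraic closure $\overline{\mathbb{Q}}_p$ of $\mathbb{Q}_p$, and $T_p^d=\{z\in\mathbb{C}_p^d : |z_i|_p=1 \text{ for all } i\}$. Let $\log_p:\mathbb{C}_p^*\to\mathbb{C}_p$ be the branch of the $p$-adic logarithm normalized by $\log_p(p)=0$. The Snirelman integral of a continuous $F:T_p^d\to\mathbb{C}_p$ is $\int_{T_p^d}F(z):=\lim_{N\to\infty,\,(N,p)=1}N^{-d}\sum_{\zeta\in\mu_N^d}F(\zeta)$, where $\mu_N\subset\overline{\mathbb{Q}}_p^*$ is the group of $N$-th roots of unity. For a countable discrete group $\Gamma$ and $f=\sum_\gamma a_\gamma\gamma\in\mathbb{Z}\Gamma$ ($a_\gamma\in\mathbb{Z}$, almost all zero; for $\Gamma=\mathbb{Z}^d$ this is identified with a Laurent polynomial via $\nu\mapsto t^\nu$), $X_f\subset(\mathbb{R}/\mathbb{Z})^\Gamma$ is the closed subgroup of all $(x_{\gamma'})_{\gamma'\in\Gamma}$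 with $\sum_{\gamma'}x_{\gamma'}a_{\gamma^{-1}\gamma'}=0$ in $\mathbb{R}/\mathbb{Z}$ for all $\gamma\in\Gamma$; $\Gamma$ acts by $\gamma\cdot(x_{\gamma'})=(x_{\gamma^{-1}\gamma'})$. For a subgroup $N$, $\mathrm{Fix}_N(X_f)$ is the set of points of $X_f$ fixed by every element of $N$. A sequence $\Gamma_n\to e$ (written $\Gamma_n\to 0$ for $\Gamma=\mathbb{Z}^d$) is a sequence of normal subgroups of finite index in $\Gamma$ such that only the neutral element lies in infinitely many $\Gamma_n$. The $p$-adic entropy with respect to $(\Gamma_n)$ is $h_p(f):=\lim_{n\to\infty}\frac{1}{(\Gamma:\Gamma_n)}\log_p|\mathrm{Fix}_{\Gamma_n}(X_f)|$ (limit in $\mathbb{Q}_p$), when the sets are finite and the limit exists. *)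

(* Defs.v *)
From HB Require Import structures.
From mathcomp Require Import all_boot all_order all_algebra.
From mathcomp Require Import finmap.
From mathcomp Require Import boolp classical_sets reals.
Set Implicit Arguments. Unset Strict Implicit. Unset Printing Implicit Defensive.
Import Order.TTheory GRing.Theory Num.Theory.
Local Open Scope ring_scope.

Definition Zd (d : nat) := 'rV[int]_d.

Definition is_subgroup d (G : set (Zd d)) : Prop :=
  G 0 /\ forall x y, G x -> G y -> G (x - y).

Definition has_index d (G : set (Zd d)) (k : nat) : Prop :=
  exists r : 'I_k -> Zd d,
    (forall nu, exists i, G (nu - r i)) /\
    (forall i j, G (r i - r j) -> i = j).

Definition tends_to_zero d (G : nat -> set (Zd d)) : Prop :=
  (forall n, is_subgroup (G n) /\ exists k, has_index (G n) k) /\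
  (forall nu : Zd d, nu != 0 -> exists M, forall n, (M <= n)%N -> ~ G n nu).

Definition laurent (d : nat) := {fsfun Zd d -> int with 0}.

(* A point of (R/Z)^(Z^d) is represented by its representative in [0,1). *)
Definition torus_pt (R : realType) d (x : Zd d -> R) : Prop :=
  forall nu, 0 <= x nu < 1.

(* X_f : sum_{gamma'} x_{gamma'} a_{gamma' - gamma} = 0 in R/Z for every gamma
   (sum written over gamma' = gamma + nu, nu in the support of f). *)
Definition X_f (R : realType) d (f : laurent d) : set (Zd d -> R) :=
  [set x | torus_pt x /\
     forall gamma : Zd d,
       (\sum_(nu <- finsupp f) x (gamma + nu) * (f nu)%:~R) \is a Num.int].

Arguments X_f R {d} f.

Definition Fix_N (R : realType) d (N : set (Zd d)) (X : set (Zd d -> R))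
  : set (Zd d -> R) :=
  [set x | X x /\ forall gamma, N gamma -> forall nu, x (nu - gamma) = x nu].

Definition has_card (T : Type) (A : set T) (c : nat) : Prop :=
  exists e : 'I_c -> T, injective e /\ forall x, A x <-> exists i, e i = x.

(* C_p, abstractly: a field K with a nonarchimedean absolute value       *)
(* restricting to the p-adic one on Z, complete, algebraically closed,   *)
(* and in which the algebraic numbers are dense.  These properties        *)
(* characterise C_p up to isometric isomorphism.                          *)

Definition abs_converges (K : fieldType) (R : realType) (abs : K -> R)
  (u : nat -> K) (l : K) : Prop :=
  forall eps : R, 0 < eps -> exists M, forall n, (M <= n)%N -> abs (u n - l) < eps.

Definition is_Cp (p : nat) (K : closedFieldType) (R : realType) (abs : K -> R)
  : Prop :=
  (forall x, abs x = 0 <-> x = 0) /\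
  (forall x y, abs (x * y) = abs x * abs y) /\
  (forall x y, abs (x + y) <= Num.max (abs x) (abs y)) /\
  (forall n : nat, (0 < n)%N -> abs n%:R = ((p%:R : R) ^- logn p n)) /\
  (forall u : nat -> K,
     (forall eps : R, 0 < eps -> exists M, forall m n,
         (M <= m)%N -> (M <= n)%N -> abs (u m - u n) < eps) ->
     exists l, abs_converges abs u l) /\
  (* K is the completion of the algebraic closure of Q inside it *)
  (forall (x : K) (eps : R), 0 < eps -> exists y : K,
     (exists q : {poly int}, q != 0 /\ root (map_poly intr q) y) /\
     abs (x - y) < eps).

(* The branch of the p-adic logarithm with log_p(p) = 0: a homomorphism
   K^× -> K, given by the usual power series on the open unit disc around 1,
   with log_p(p) = 0 (this determines it uniquely on K^×). *)
Definition is_logp (p : nat) (K : closedFieldType) (R : realType) (abs : K -> R)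
  (logp : K -> K) : Prop :=
  [/\ forall x y, x != 0 -> y != 0 -> logp (x * y) = logp x + logp y,
      logp p%:R = 0
    & forall x, abs (x - 1) < 1 ->
        abs_converges abs
          (fun n => \sum_(1 <= i < n.+1) ((-1) ^+ i.+1 * (x - 1) ^+ i / i%:R))
          (logp x)].

Definition leval d (K : closedFieldType) (f : laurent d) (z : 'I_d -> K) : K :=
  \sum_(nu <- finsupp f) (f nu)%:~R * \prod_(i < d) (z i ^ (nu ord0 i)).

Definition in_Tp d (K : closedFieldType) (R : realType) (abs : K -> R)
  (z : 'I_d -> K) : Prop :=
  forall i, abs (z i) = 1.

Definition is_mu_seq (K : closedFieldType) (N : nat) (s : seq K) : Prop :=
  uniq s /\ forall x, (x \in s) = (x ^+ N == 1).

Definition mu_seq (K : closedFieldType) (N : nat) : seq K :=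
  match pselect (exists s, is_mu_seq N s) with
  | left h => projT1 (cid h)
  | right _ => [::]
  end.

Definition snirelman_avg d (K : closedFieldType) (F : ('I_d -> K) -> K)
  (N : nat) : K :=
  (N%:R ^+ d)^-1 *
  \sum_(k : {ffun 'I_d -> 'I_(size (mu_seq K N))})
     F (fun i => nth 0 (mu_seq K N) (k i)).

Definition snirelman_integral_is (p : nat) d (K : closedFieldType)
  (R : realType) (abs : K -> R) (F : ('I_d -> K) -> K) (l : K) : Prop :=
  forall eps : R, 0 < eps -> exists M, forall N, (M <= N)%N -> coprime N p ->
    abs (snirelman_avg F N - l) < eps.

(* Main.v *)
Require Import Defs.
From HB Require Import structures.
From mathcomp Require Import all_boot all_order all_algebra.
From mathcomp Require Import finmap.
From mathcomp Require Import boolp classical_sets reals.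
From mathcomp Require cyclic separable cyclotomic.
From mathcomp Require Import ring lra zify.
Set Implicit Arguments. Unset Strict Implicit. Unset Printing Implicit Defensive.
Import Order.TTheory GRing.Theory Num.Theory.
Local Open Scope ring_scope.

(* If two coefficients of f had maximal absolute value, the Kronecker
   substitution t_i = t^(B^i) would give a one-variable polynomial with the same
   property, hence with a root of absolute value 1, and f would vanish on T_p^d.
   So f = b t^nu0 (1 + H) where all coefficients of H have absolute value at
   most rho < 1. Since log_p kills roots of unity, averaging log_p f over a
   finite set of torsion points z_j with avg z^nu = [nu in G] amounts to
   averaging the series log (1 + H), and the average of H^i is the sum of the
   coefficients of H^i over G. When G avoids a large finite set of nonzero
   vectors, this is the constant coefficient for all small i, while the
   remaining terms are at most i rho^i; so all these averages approach the same
   limit. The points of mu_N^d form such a set for G = N Z^d. The characters of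
   Z^d / G_n form one for G = G_n: they are obtained by diagonalizing
   simultaneously the translations of Z^d / G_n, so that the product of their
   f-values is the determinant of convolution by f, and by the Smith normal
   form the absolute value of this determinant counts the fixed points. *)

(** * Cardinalities of finite sets *)

Lemma has_card_finType T (A : set T) (I : finType) (e : I -> T) :
  injective e -> (forall x, A x <-> exists i, e i = x) -> has_card A #|I|.
Proof.
move=> e_inj eA; exists (e \o enum_val); split.
  by apply: inj_comp => //; exact: enum_val_inj.
move=> x; rewrite eA; split=> [[i <-]|[i <-]]; last by exists (enum_val i).
by exists (enum_rank i); rewrite /= enum_rankK.
Qed.

Lemma has_card_le T (A : set T) c c' :
  has_card A c -> has_card A c' -> (c <= c')%N.
Proof.
move=> [e [e_inj eA]] [e' [e'_inj e'A]].
have /choice[g gP] i : exists j, e' j = e i by apply/e'A/eA; exists i.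
have g_inj : injective g by move=> i j gij; apply: e_inj; rewrite -!gP gij.
by have := leq_card g g_inj; rewrite !card_ord.
Qed.

Lemma has_card_uniq T (A : set T) c c' :
  has_card A c -> has_card A c' -> c = c'.
Proof. by move=> Ac Ac'; apply/eqP; rewrite eqn_leq !(@has_card_le _ A). Qed.

Lemma has_card_bij T U (A : set T) (B : set U) (g : T -> U) c :
  (forall x, A x -> B (g x)) ->
  (forall x y, A x -> A y -> g x = g y -> x = y) ->
  (forall y, B y -> exists2 x, A x & g x = y) ->
  has_card A c -> has_card B c.
Proof.
move=> AB g_inj g_surj [e [e_inj eA]]; exists (g \o e); split.
  move=> i j /= /g_inj eij; apply: e_inj; apply: eij; apply/eA.
    by exists i.
  by exists j.
move=> y; split=> [/g_surj[x /eA[i <-] <-]|[i <-]]; first by exists i.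
by apply: AB; apply/eA; exists i.
Qed.

(** * Counting the points of the unit cube that an integer matrix sends to integral vectors *)

Section IntegralSolutions.
Context (R : realType).
Implicit Types (k : nat) (x : R).

Definition frac x : R := x - (Num.floor x)%:~R.

Lemma frac_itv x : 0 <= frac x < 1.
Proof.
have := floor_itv x; rewrite intrD mulr1z /frac; move=> /andP[? ?].
by apply/andP; split; lra.
Qed.

Lemma int_itv_eq0 x : x \is a Num.int -> -1 < x < 1 -> x = 0.
Proof.
move=> /intrP[m ->]; rewrite (ltr_int R (-1) m) (ltr_int R m 1) => h.
by have -> : m = 0 by lia.
Qed.

Lemma itv_int_eq x y : 0 <= x < 1 -> 0 <= y < 1 -> x - y \is a Num.int -> x = y.
Proof.
move=> /andP[? ?] /andP[? ?] /int_itv_eq0 h; apply/eqP; rewrite -subr_eq0.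
by apply/eqP/h/andP; split; lra.
Qed.

Definition intvec k (y : 'cV[R]_k) : Prop := forall i, y i 0 \is a Num.int.

Lemma intvecB k (y z : 'cV[R]_k) : intvec y -> intvec z -> intvec (y - z).
Proof. by move=> hy hz i; rewrite !mxE rpredB. Qed.

Lemma intvec_mul k (M : 'M[int]_k) (y : 'cV[R]_k) :
  intvec y -> intvec (map_mx intr M *m y).
Proof. by move=> hy i; rewrite mxE rpred_sum // => j _; rewrite mxE rpredM ?intr_int. Qed.

Lemma intvec_unit k (M : 'M[int]_k) (y : 'cV[R]_k) :
  M \in unitmx -> intvec (map_mx intr M *m y) <-> intvec y.
Proof.
move=> uM; split; last exact: intvec_mul.
move=> /(intvec_mul (invmx M)); rewrite mulmxA -map_mxM /= mulVmx //.
by rewrite map_mx1 mul1mx.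
Qed.

Definition fracvec k (y : 'cV[R]_k) : 'cV[R]_k := map_mx frac y.

Lemma fracvecE k (y : 'cV[R]_k) : intvec (y - fracvec y).
Proof. by move=> i; rewrite !mxE /frac opprB addrC subrK intr_int. Qed.

(** By the Smith normal form, [A = L D U] with [L] and [U] unimodular. Removing [L] does not affect
    integrality, and [U] acts bijectively on vectors modulo integral ones, so only the diagonal case
    has to be counted. *)
Lemma has_card_int_solutions k (A : 'M[int]_k) : \det A != 0 ->
  has_card [set y : 'cV[R]_k | (forall i, 0 <= y i 0 < 1) /\
                               intvec (map_mx intr A *m y)] `|\det A|%N.
Proof.
have [L uL [U uU [ds _ ->]]] := int_Smith_normal_form A.
set D := \matrix_(i, j) _.
have DE : D = diag_mx (\row_i ds`_i).
  apply/matrixP => i j; rewrite !mxE; case: (i =P j) => [->|/eqP] //.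
    by rewrite ?eqxx.
  by rewrite -val_eqE /= => /negPf->.
have absz_unit (M : 'M[int]_k) : M \in unitmx -> `|\det M|%N = 1%N.
  by rewrite unitmxE unfold_in => /orP[] /eqP->.
rewrite !det_mulmx !abszM (absz_unit L) // (absz_unit U) // mul1n muln1.
rewrite !mulf_eq0 !negb_or -andbA.
move=> /and3P[_ D0 _].
have d0 i : ds`_(i : 'I_k) != 0.
  move: D0; rewrite DE det_diag prodf_seq_neq0 => /allP /(_ i).
  by rewrite mem_index_enum mxE => /(_ isT).
(* For [D] alone, the solutions in the unit cube are the vectors with entries [t i / |d_i|], where
   [0 <= t i < |d_i|]; [w] lists them. *)
pose T := {dffun forall i : 'I_k, 'I_(absz ds`_i)}.
have -> : `|\det D|%N = #|T|.
  rewrite card_dep_ffun foldrE big_map DE det_diag.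
  rewrite (big_morph absz abszM (erefl _)) big_enum.
  by apply: eq_bigr => i _; rewrite card_ord mxE.
pose w (t : T) : 'cV[R]_k := \col_i ((t i)%:R / (absz ds`_i)%:R).
have dpos i : 0 < (absz ds`_(i : 'I_k))%:R :> R by rewrite ltr0n absz_gt0.
have dsE i : (ds`_i)%:~R = (-1) ^+ (ds`_i < 0)%R * (absz ds`_i)%:R :> R.
  by rewrite {1}[ds`_i]intEsign rmorphM rmorph_sign.
have w_itv t i : 0 <= w t i 0 < 1.
  by rewrite mxE divr_ge0 ?ler0n //= ltr_pdivrMr // mul1r ltr_nat.
have DM (y : 'cV[R]_k) i : (map_mx intr D *m y) i 0 = (ds`_i)%:~R * y i 0.
  by rewrite DE map_diag_mx mul_diag_mx !mxE.
have key (y : 'cV[R]_k) : intvec (map_mx intr (L *m D *m U) *m y) <->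
    intvec (map_mx intr D *m (map_mx intr U *m y)).
  by rewrite !map_mxM /= -!mulmxA; exact: intvec_unit.
have UV y : map_mx intr U *m (map_mx intr (invmx U) *m y) = y :> 'cV[R]_k.
  by rewrite mulmxA -map_mxM /= mulmxV // map_mx1 mul1mx.
have intD (y : 'cV[R]_k) : intvec y -> intvec (map_mx intr D *m y) by apply: intvec_mul.
apply: (@has_card_finType _ _ _ (fun t => fracvec (map_mx intr (invmx U) *m w t))).
  move=> t t' tt'; set y := fracvec _ in tt'.
  have h := fracvecE (map_mx intr (invmx U) *m w t').
  have := fracvecE (map_mx intr (invmx U) *m w t).
  rewrite -/y tt' => /intvecB /(_ h).
  rewrite [X in intvec X](_ : _ = map_mx intr (invmx U) *m (w t - w t')); last first.
    by rewrite mulmxBr opprB addrA subrK.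
  move=> /(intvec_mul U); rewrite UV => ww.
  apply/ffunP => i; apply/val_inj/eqP; rewrite -(eqr_nat R).
  have /eqP : w t i 0 = w t' i 0.
    by apply: itv_int_eq => //; have := ww i; rewrite [(w t - w t') _ _]mxE [(- w t') _ _]mxE.
  by rewrite !mxE (inj_eq (mulIf _)) // invr_neq0 // gt_eqF.
move=> y; split; last first.
  move=> [t <-]; split; first by move=> i; rewrite mxE frac_itv.
  apply/key.
  set x := _ *m w t.
  have -> : fracvec x = x - (x - fracvec x) by rewrite opprB addrC subrK.
  rewrite mulmxBr mulmxBr UV; apply: intvecB; last first.
    by apply: intD; apply: intvec_mul; exact: fracvecE.
  move=> i; rewrite DM dsE -mulrA rpredMsign mxE.
  by rewrite mulrCA mulfV ?mulr1 ?gt_eqF // natr_int.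
move=> [y01 /key iy].
pose u := fracvec (map_mx intr U *m y).
have iu : intvec (map_mx intr D *m u).
  have -> : u = map_mx intr U *m y - (map_mx intr U *m y - u) by rewrite opprB addrC subrK.
  by rewrite mulmxBr; apply: intvecB => //; apply: intD; exact: fracvecE.
have u01 i : 0 <= u i 0 < 1 by rewrite mxE frac_itv.
have uE (i : 'I_k) : exists n : 'I_(absz ds`_i), u i 0 = n%:R / (absz ds`_i)%:R.
  have /intrP[m mE] : (absz ds`_i)%:R * u i 0 \is a Num.int.
    by have := iu i; rewrite DM dsE -mulrA rpredMsign.
  have /andP[u0 u1] := u01 i.
  have m0 : 0 <= m by rewrite -(ler0z R) -mE mulr_ge0 // ltW.
  have mE' : m = absz m by rewrite gez0_abs.
  have lt_m : (absz m < absz (ds`_i)%R)%N.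
    by rewrite -(ltr_nat R) -[X in X < _]/((absz m : int)%:~R) -mE' -mE gtr_pMr.
  exists (Ordinal lt_m) => /=; apply: (canRL (mulfK _)); first by rewrite gt_eqF.
  by rewrite mulrC mE {1}mE' -pmulrn.
have /fin_all_exists[t tE] := uE.
exists (finfun t).
have -> : w (finfun t) = u.
  by apply/colP => i; rewrite mxE ffunE tE.
(* Both vectors lie in the unit cube, so it is enough that they differ by an integral vector. *)
apply/colP => i; rewrite mxE; symmetry; apply: itv_int_eq => //; first exact: frac_itv.
have hu := intvec_mul (invmx U) (fracvecE (map_mx intr U *m y)).
have hv := fracvecE (map_mx intr (invmx U) *m u).
move: hu; rewrite mulmxBr mulmxA -map_mxM /= mulVmx // map_mx1 mul1mx.
set v := _ *m u in hv * => hu.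
have <- : (y - v) i 0 + (v - fracvec v) i 0 = y i 0 - frac (v i 0).
  by rewrite !mxE addrA subrK.
by rewrite rpredD.
Qed.

End IntegralSolutions.

(** * Matrices of finite order *)

Lemma prod_root_unity (K : closedFieldType) m : (m%:R != 0 :> K) ->
  {rs : seq K | uniq rs & 'X^m - 1 = \prod_(x <- rs) ('X - x%:P)}.
Proof.
move=> m0; have m_gt0 : (0 < m)%N by case: m m0 => //; rewrite eqxx.
have [rs rsE] := closed_field_poly_normal ('X^m - 1 : {poly K}).
have mon : 'X^m - 1 \is @monic K by rewrite -(prednK m_gt0) monicXnsubC.
move: rsE; rewrite (monicP mon) scale1r => rsE; exists rs => //.
by rewrite -separable.separable_prod_XsubC -rsE cyclotomic.separable_Xn_sub_1.
Qed.

(** The minimal polynomial divides [X^m - 1], which splits with simple roots because [m] is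
    invertible in [K]. *)
Lemma diagonalizable_root_unity (K : closedFieldType) n (A : 'M[K]_n) m :
  (0 < n)%N -> m%:R != 0 :> K -> iter m (mulmx A) 1%:M = 1%:M ->
  diagonalizable A.
Proof.
case: n A => // n A _ m0 Am'; apply/diagonalizableP.
have Am : A ^+ m = 1.
  by rewrite -[RHS]Am'; elim: (m) => [|i IHi] //=; rewrite exprS IHi.
have [rs rs_uniq rsE] := prod_root_unity m0; exists rs => //.
rewrite -rsE; apply: mxminpoly_min.
by rewrite rmorphB rmorph1 rmorphXn /= horner_mx_X Am subrr.
Qed.

(** * Monomials and characters of Z^d *)

Definition monom d (K : fieldType) (nu : Zd d) (z : 'I_d -> K) : K :=
  \prod_(i < d) (z i ^ (nu ord0 i)).

(** A character is determined by its values on the standard basis, so characters of Z^d correspond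
    to points with nonzero coordinates. *)
Lemma hom_monom d (K : fieldType) (chi : Zd d -> K) :
  chi 0 = 1 -> (forall nu mu, chi (nu + mu) = chi nu * chi mu) ->
  forall nu, chi nu = monom nu (fun i => chi (delta_mx 0 i)).
Proof.
move=> chi0 chiD nu.
have chiN mu : chi (- mu) = (chi mu)^-1.
  have h : chi (- mu) * chi mu = 1 by rewrite -chiD addNr.
  have mu0 : chi mu != 0 by apply/eqP => e; move/eqP: h; rewrite e mulr0 eq_sym oner_eq0.
  by rewrite -[LHS](mulfK mu0) h mul1r.
have chin mu n : chi (mu *+ n) = chi mu ^+ n.
  by elim: n => [|n IHn]; rewrite ?mulr0n ?expr0 // mulrS chiD IHn exprS.
have chiz mu (a : int) : chi (a *: mu) = chi mu ^ a.
  case: (intP a) => [|n|n].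
  - by rewrite scale0r chi0 expr0z.
  - by rewrite -[in LHS](natz n.+1) scaler_nat chin.
  - by rewrite scaleNr chiN -[in LHS](natz n.+1) scaler_nat chin -exprnN.
rewrite /monom {1}(matrix_sum_delta nu) big_ord1 (big_morph chi chiD chi0).
by apply: eq_bigr => i _; rewrite chiz.
Qed.

(** * The finite quotient Z^d / G, with class map [cl] and section [r] *)

Section Quotient.
Context (d k : nat) (G : set (Zd d)) (r : 'I_k -> Zd d) (cl : Zd d -> 'I_k).
Hypothesis clK : cancel r cl.
Hypothesis clP : forall nu mu, cl nu = cl mu <-> G (nu - mu).
Implicit Types (nu mu : Zd d) (f : laurent d).

Lemma cl_repr nu mu : cl (r (cl nu) + mu) = cl (nu + mu).
Proof.
apply/clP; rewrite opprD addrACA subrr addr0.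
by apply/clP; rewrite clK.
Qed.

(** The translation operator on functions on Z^d / G, taking [y] to [i |-> y (cl (r i + nu))]. *)
Definition shiftmx (F : pzSemiRingType) nu : 'M[F]_k :=
  \matrix_(i, j) (cl (r i + nu) == j)%:R.

(** The ring is a parameter because the matrix is read twice: over [int] its determinant counts
    fixed points, over [K] it is diagonalized. *)
Definition convmx (F : pzRingType) f : 'M[F]_k :=
  \sum_(nu <- finsupp f) (f nu)%:~R *: shiftmx F nu.

Lemma shiftmxD (F : pzSemiRingType) nu mu :
  shiftmx F (nu + mu) = shiftmx F nu *m shiftmx F mu.
Proof.
apply/matrixP => i j; rewrite !mxE (bigD1 (cl (r i + nu))) //= !mxE eqxx mul1r.
rewrite cl_repr addrA big1 ?addr0 // => l /negPf.
by rewrite !mxE eq_sym => ->; rewrite mul0r.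
Qed.

Lemma shiftmx0 (F : pzSemiRingType) : shiftmx F 0 = 1%:M.
Proof. by apply/matrixP => i j; rewrite !mxE addr0 clK. Qed.

Lemma mxtrace_shiftmx (F : pzSemiRingType) nu :
  \tr (shiftmx F nu) = if `[< G nu >] then k%:R else 0.
Proof.
have H i : (cl (r i + nu) == i) = `[< G nu >].
  apply/eqP/asboolP; first by rewrite -{2}(clK i) => /clP; rewrite addrAC subrr add0r.
  by move=> Gnu; rewrite -[RHS]clK; apply/clP; rewrite addrAC subrr add0r.
rewrite /mxtrace; under eq_bigr do rewrite mxE H.
by case: asboolP => _; [rewrite sumr_const card_ord | rewrite big1].
Qed.

(** Only the class of [nu] matters, so the translations form a finite list, as simultaneous
    diagonalization requires. *)
Lemma shiftmx_eq (F : pzSemiRingType) nu : shiftmx F nu = shiftmx F (r (cl nu)).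
Proof.
by apply/matrixP => i j; rewrite !mxE [r i + r _]addrC cl_repr addrC.
Qed.

Lemma shiftmx_finite_order (F : pzSemiRingType) nu :
  exists2 m, (0 < m <= k)%N & shiftmx F (nu *+ m) = 1%:M.
Proof.
(* Pigeonhole: two of the [k + 1] multiples [0, nu, ..., k nu] share a class. *)
pose g (i : 'I_k.+1) := cl (nu *+ i).
have /injectivePn[i [j neq_ij gij]] : ~~ injectiveb g.
  by apply/negP => /injectiveP /leq_card; rewrite !card_ord ltnn.
wlog lt_ij : i j neq_ij gij / (i < j)%N.
  move=> IH; case: (ltngtP i j) => [||/val_inj ij]; first exact: IH.
    by apply: IH; rewrite // eq_sym.
  by rewrite ij eqxx in neq_ij.
exists (j - i)%N; first by rewrite subn_gt0 lt_ij /=; have := ltn_ord j; lia.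
rewrite -shiftmx0 [LHS]shiftmx_eq [RHS]shiftmx_eq; congr (shiftmx F (r _)).
apply/clP; rewrite subr0 mulrnBr; last exact: ltnW.
by apply/clP.
Qed.

Lemma convmx_int (F : pzRingType) f : convmx F f = map_mx intr (convmx int f).
Proof.
rewrite /convmx raddf_sum; apply: eq_bigr => nu _.
by apply/matrixP => i j; rewrite !mxE /= intrM intz; case: (_ == j).
Qed.

Lemma convmxE (F : pzRingType) f (y : 'cV[F]_k) i :
  (convmx F f *m y) i 0 = \sum_(nu <- finsupp f) (f nu)%:~R * y (cl (r i + nu)) 0.
Proof.
rewrite mulmx_suml summxE; apply: eq_bigr => nu _.
rewrite -scalemxAl mxE; congr (_ * _).
rewrite mxE (bigD1 (cl (r i + nu))) //= !mxE eqxx mul1r big1 ?addr0 // => l /negPf.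
by rewrite !mxE eq_sym => ->; rewrite mul0r.
Qed.

(** Points fixed by [G] are the functions on Z^d / G, and for these the equations of [X_f] say that
    [convmx] maps the vector of values to an integral vector. *)
Lemma has_card_Fix (R : realType) f : \det (convmx int f) != 0 ->
  has_card (Fix_N G (X_f R f)) `|\det (convmx int f)|%N.
Proof.
move=> /(has_card_int_solutions R); rewrite -convmx_int.
apply: (@has_card_bij _ _ _ _ (fun (y : 'cV[R]_k) nu => y (cl nu) 0)).
- move=> y /= [y01 iy]; split; [split=> [nu|gamma]|] => //=.
    have := iy (cl gamma); rewrite convmxE; apply: etrans; congr (_ \is a _).
    by apply: eq_bigr => nu _; rewrite cl_repr mulrC.
  by move=> gamma Gg nu; congr (y _ 0); apply/esym/clP; rewrite opprB addrC subrK.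
- move=> x y _ _ xy; apply/colP => i.
  by have := congr1 (@^~ (r i)) xy; rewrite /= clK.
move=> x /= [[x01 ix] xG].
have xcl nu : x (r (cl nu)) = x nu.
  have /xG/(_ nu)<- : G (nu - r (cl nu)) by apply/clP; rewrite clK.
  by rewrite opprB addrC subrK.
exists (\col_i x (r i)); last by apply/funext => nu; rewrite mxE.
split=> i; first by rewrite mxE.
rewrite convmxE; have := ix (r i); apply: etrans; congr (_ \is a _).
by apply: eq_bigr => nu _; rewrite mxE xcl mulrC.
Qed.

Lemma codiagonalize_shiftmx (K : closedFieldType) :
  (forall n, (0 < n)%N -> n%:R != 0 :> K) -> (0 < k)%N ->
  exists2 V : 'M[K]_k, V \in unitmx &
    exists D : Zd d -> 'rV[K]_k, forall nu, V *m shiftmx K nu = diag_mx (D nu) *m V.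
Proof.
move=> char0 k_gt0.
have /codiagonalizableP[V uV /allP Vd] :
    {in [seq shiftmx K (r i) | i : 'I_k] &, forall A B, comm_mx A B} /\
    (forall A, A \in [seq shiftmx K (r i) | i : 'I_k] -> diagonalizable A).
  split=> [A B /codomP[i ->] /codomP[j ->]|A /codomP[i ->]].
    by rewrite /comm_mx -!shiftmxD addrC.
  have [m /andP[m_gt0 _] rm] := shiftmx_finite_order K (r i).
  apply: (@diagonalizable_root_unity _ _ _ m) => //; first exact: char0.
  rewrite -[RHS]rm; elim: (m) => [|n IHn]; first by rewrite mulr0n shiftmx0.
  by rewrite iterS IHn mulrS shiftmxD.
exists V => //.
have /choice[D DE] nu : exists Dnu : 'rV[K]_k, V *m shiftmx K nu = diag_mx Dnu *m V.
  have /Vd : shiftmx K nu \in [seq shiftmx K (r i) | i : 'I_k].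
    by rewrite shiftmx_eq; apply: codom_f.
  move=> /diagonalizable_forPex[Dnu sim]; exists Dnu; apply: simmxPp sim.
  by rewrite stablemx_unit.
by exists D.
Qed.

(** In a common eigenbasis, the [j]-th eigenvalue of translation by [nu] is multiplicative in [nu],
    hence is the monomial [nu] at a point [z j]. Finite order makes its coordinates roots of unity;
    the trace of a translation gives the orthogonality relation, and the diagonal form of [convmx]
    gives its determinant. *)
Lemma quotient_characters (K : closedFieldType) :
  (forall n, (0 < n)%N -> n%:R != 0 :> K) -> (0 < k)%N ->
  exists z : 'I_k -> 'I_d -> K,
    [/\ forall j i, exists2 m, (0 < m)%N & z j i ^+ m = 1,
        forall nu, \sum_j monom nu (z j) = if `[< G nu >] then k%:R else 0
      & forall f, \det (convmx K f) = \prod_j leval f (z j)].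
Proof.
move=> char0 k_gt0; have [V uV [D VD]] := codiagonalize_shiftmx char0 k_gt0.
have diagV A B : diag_mx A *m V = diag_mx B *m V -> A = B :> 'rV[K]_k.
  by move=> /(congr1 (mulmx^~ (invmx V))); rewrite !mulmxK // => /matrixP AB;
     apply/rowP => j; have := AB j j; rewrite !mxE eqxx.
have D0 : D 0 = const_mx 1.
  by apply: diagV; rewrite -VD shiftmx0 mulmx1 diag_const_mx mul1mx.
have DD nu mu : D (nu + mu) = \row_j (D nu 0 j * D mu 0 j).
  apply: diagV; rewrite -mulmx_diag -VD shiftmxD mulmxA VD -!mulmxA; congr (_ *m _).
  exact: VD.
pose z j i := D (delta_mx 0 i) 0 j.
have Dz nu j : D nu 0 j = monom nu (z j).
  by apply: (@hom_monom _ _ (fun nu => D nu 0 j)); rewrite ?D0 ?mxE // => x y; rewrite DD mxE.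
have DE nu : diag_mx (D nu) = V *m shiftmx K nu *m invmx V by rewrite VD mulmxK.
exists z; split.
- move=> j i; have [m /andP[m_gt0 _] rm] := shiftmx_finite_order K (delta_mx 0 i).
  exists m => //; have : D (delta_mx 0 i *+ m) 0 j = 1.
    have /diagV-> : diag_mx (D (delta_mx 0 i *+ m)) *m V = diag_mx (const_mx 1) *m V.
      by rewrite -VD rm mulmx1 diag_const_mx mul1mx.
    by rewrite mxE.
  move=> <-; rewrite /z; elim: (m) => [|n IHn]; first by rewrite mulr0n expr0 D0 mxE.
  by rewrite exprS IHn mulrS DD mxE.
- move=> nu; rewrite -mxtrace_shiftmx -(mulKmx uV (shiftmx K nu)) VD mxtrace_mulC mulmxK //.
  by rewrite mxtrace_diag; apply: eq_bigr => j _; rewrite Dz.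
move=> f; have -> : \det (convmx K f) = \det (V *m convmx K f *m invmx V).
  by rewrite !det_mulmx det_inv mulrAC mulfV ?mul1r // -unitfE -unitmxE.
have -> : V *m convmx K f *m invmx V = diag_mx (\row_j leval f (z j)).
  rewrite /convmx mulmx_sumr mulmx_suml; apply/matrixP => i j.
  rewrite summxE !mxE.
  under eq_bigr do rewrite -scalemxAr -scalemxAl -DE 2!mxE mulrnAr Dz.
  by rewrite -sumrMnl.
by rewrite det_diag; apply: eq_bigr => j _; rewrite mxE.
Qed.

End Quotient.

Lemma index_class d k (G : set (Zd d)) : is_subgroup G -> has_index G k ->
  exists r cl, [/\ (0 < k)%N, cancel r cl &
    forall nu mu : Zd d, cl nu = cl mu :> 'I_k <-> G (nu - mu)].
Proof.
move=> [G0 GB] [r [/choice[cl clP] r_inj]]; exists r, cl.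
have GN x : G x -> G (- x) by move=> Gx; rewrite -sub0r; exact: GB.
split; first exact: leq_ltn_trans (leq0n _) (ltn_ord (cl 0)).
  by move=> i; apply: r_inj; rewrite -opprB; apply/GN/clP.
move=> nu mu; split=> [clE|Gnm].
  have := GB _ _ (clP nu) (clP mu); rewrite clE.
  by rewrite opprB addrA subrK.
apply: r_inj; have := GB _ _ Gnm (GB _ _ (clP nu) (clP mu)).
by congr (G _); apply/rowP => i; rewrite !mxE; ring.
Qed.

(** * Uniqueness of base [B] digits, for the Kronecker substitution *)

Lemma base_expansion_inj d B (e e' : 'I_d -> nat) :
  (forall i, e i < B)%N -> (forall i, e' i < B)%N ->
  (\sum_i e i * B ^ i = \sum_i e' i * B ^ i)%N -> e =1 e'.
Proof.
elim: d e e' => [|d IH] e e' lt_e lt_e'; first by move=> _ [].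
rewrite !big_ord_recl !muln1.
have shift (g : 'I_d.+1 -> nat) : (\sum_(i < d) g (lift ord0 i) * B ^ (lift ord0 i) =
    (\sum_(i < d) g (lift ord0 i) * B ^ i) * B)%N.
  by rewrite big_distrl; apply: eq_bigr => i _; rewrite lift0 expnS mulnCA mulnC.
rewrite !shift => E.
have E0 : e ord0 = e' ord0.
  by move: (congr1 (modn^~ B) E); rewrite /= ![(_ + _ * B)%N]addnC !modnMDl !modn_small.
move: E; rewrite E0 => /addnI /eqP; rewrite eqn_pmul2r; last first.
  by apply: leq_ltn_trans (lt_e ord0).
move=> /eqP /IH E i; case: (unliftP ord0 i) => [j ->|-> //]; exact: E.
Qed.

(** * The nonarchimedean absolute value *)

Section Ultrametric.
Context (p : nat) (K : closedFieldType) (R : realType) (abs : K -> R).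
Hypotheses (p_prime : prime p) (Cp : is_Cp p abs).
Implicit Types x y : K.

Lemma abs_eq0 x : (abs x == 0) = (x == 0).
Proof. by have [h _] := Cp; apply/eqP/eqP => /h. Qed.

Lemma absM x y : abs (x * y) = abs x * abs y.
Proof. by have [_ [h _]] := Cp. Qed.

Lemma absD_le x y : abs (x + y) <= Num.max (abs x) (abs y).
Proof. by have [_ [_ [h _]]] := Cp. Qed.

Lemma abs0 : abs 0 = 0.
Proof. by apply/eqP; rewrite abs_eq0. Qed.

(* Every element is a square. *)
Lemma abs_ge0 x : 0 <= abs x.
Proof.
have [y] := @solve_monicpoly K 2 (fun i => if i == 0%N then x else 0) isT.
rewrite big_ord_recl big_ord1 /= mulr1 mul0r addr0 => <-.
by rewrite expr2 absM -expr2 sqr_ge0.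
Qed.

Lemma abs1 : abs 1 = 1.
Proof.
have n0 : abs 1 != 0 by rewrite abs_eq0 oner_eq0.
by apply: (mulfI n0); rewrite -absM !mulr1.
Qed.

Lemma absX x n : abs (x ^+ n) = abs x ^+ n.
Proof. by elim: n => [|n IHn]; rewrite ?expr0 ?abs1 // !exprS absM IHn. Qed.

Lemma abs_unity_root x n : (0 < n)%N -> x ^+ n = 1 -> abs x = 1.
Proof.
move=> n_gt0 /(congr1 abs); rewrite absX abs1 => /eqP.
by rewrite pexpr_eq1 ?abs_ge0 // => /eqP.
Qed.

Lemma absN x : abs (- x) = abs x.
Proof. by rewrite -mulN1r absM (@abs_unity_root (-1) 2) ?mul1r // sqrrN expr1n. Qed.

Lemma absV x : abs x^-1 = (abs x)^-1.
Proof.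
have [->|x0] := eqVneq x 0; first by rewrite invr0 abs0 invr0.
have n0 : abs x != 0 by rewrite abs_eq0.
by apply: (mulfI n0); rewrite -absM !mulfV // abs1.
Qed.

Lemma abs_prod I (r : seq I) (P : pred I) (F : I -> K) :
  abs (\prod_(i <- r | P i) F i) = \prod_(i <- r | P i) abs (F i).
Proof. exact: (big_morph abs absM abs1). Qed.

Lemma abs_exprz x (n : int) : abs x = 1 -> abs (x ^ n) = 1.
Proof.
move=> x1; case: n => n; rewrite ?NegzE -?exprnP -?exprnN ?absV absX x1 expr1n //.
by rewrite invr1.
Qed.

Lemma absD_lt x y e : abs x < e -> abs y < e -> abs (x + y) < e.
Proof. by move=> xe ye; apply: le_lt_trans (absD_le _ _) _; rewrite gt_max xe ye. Qed.

Lemma abs_sum_le (I : eqType) (r : seq I) (P : pred I) (F : I -> K) e : 0 <= e ->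
  (forall i, i \in r -> P i -> abs (F i) <= e) -> abs (\sum_(i <- r | P i) F i) <= e.
Proof.
move=> e0 h; rewrite big_seq_cond; elim/big_ind: _; rewrite ?abs0 //.
  2: by move=> i /andP[]; exact: h.
by move=> x y xe ye; apply: le_trans (absD_le _ _) _; rewrite ge_max xe ye.
Qed.

Lemma abs_sum_lt (I : eqType) (r : seq I) (P : pred I) (F : I -> K) e : 0 < e ->
  (forall i, i \in r -> P i -> abs (F i) < e) -> abs (\sum_(i <- r | P i) F i) < e.
Proof.
move=> e0 h; rewrite big_seq_cond; elim/big_ind: _; rewrite ?abs0 //.
  2: by move=> i /andP[]; exact: h.
by move=> x y; exact: absD_lt.
Qed.

Lemma absD_dominant x y : abs y < abs x -> abs (x + y) = abs x.
Proof.
move=> yx; apply/eqP; rewrite eq_le; apply/andP; split.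
  by apply: le_trans (absD_le _ _) _; rewrite ge_max lexx ltW.
have := absD_le (x + y) (- y); rewrite addrK absN le_max => /orP[//|].
by rewrite leNgt yx.
Qed.

Lemma natr_abs_neq0 n : (0 < n)%N -> n%:R != 0 :> K.
Proof.
move=> n_gt0; rewrite -abs_eq0; have [_ [_ [_ [h _]]]] := Cp.
by rewrite h // invr_neq0 // expf_neq0 // pnatr_eq0 -lt0n prime_gt0.
Qed.

(** For positive [n] the left side is the largest power of [p] dividing [n]. This controls the
    denominators of the logarithm series. *)
Lemma abs_natV n : abs n%:R^-1 <= n%:R.
Proof.
case: n => [|n]; first by rewrite invr0 abs0.
have [_ [_ [_ [h _]]]] := Cp.
by rewrite absV h // invrK -natrX ler_nat dvdn_leq // pfactor_dvdnn.
Qed.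

(** * Polynomials with a unique coefficient of maximal absolute value *)

Definition dominant (q : {poly K}) i := forall j, j != i -> abs q`_j < abs q`_i.

Lemma dominant_gt0 q i : dominant q i -> 0 < abs q`_i.
Proof.
by move=> /(_ i.+1 _); rewrite gtn_eqF // => /(_ isT); apply: le_lt_trans; exact: abs_ge0.
Qed.

(** As in the Gauss lemma: among all products of a coefficient of [q] and one of [s], only the pair
    [(i, j)] reaches the maximum, so nothing can cancel it in degree [i + j]. *)
Lemma dominantM q s i j : dominant q i -> dominant s j -> dominant (q * s) (i + j)%N.
Proof.
move=> qi sj; have qi0 := dominant_gt0 qi; have sj0 := dominant_gt0 sj.
have le_q l : abs q`_l <= abs q`_i by have [->//|/qi/ltW] := eqVneq l i.
have le_s l : abs s`_l <= abs s`_j by have [->//|/sj/ltW] := eqVneq l j.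
have small l m : (l, m) != (i, j) -> abs (q`_l * s`_m) < abs q`_i * abs s`_j.
  rewrite xpair_eqE negb_and absM => /orP[/qi h|/sj h].
    by apply: le_lt_trans (ler_wpM2l (abs_ge0 _) (le_s m)) _; rewrite ltr_pM2r.
  by apply: le_lt_trans (ler_wpM2r (abs_ge0 _) (le_q l)) _; rewrite ltr_pM2l.
have coef_ij : abs (q * s)`_(i + j) = abs q`_i * abs s`_j.
  have lt_i : (i < (i + j).+1)%N by rewrite ltnS leq_addr.
  rewrite coefM (bigD1 (Ordinal lt_i)) //= addKn absD_dominant absM //.
  apply: abs_sum_lt => [|l _ l_i]; first exact: mulr_gt0.
  by apply: small; apply: contra l_i => /eqP[l_i _]; apply/eqP/val_inj.
move=> n n_ij; rewrite coef_ij coefM; apply: abs_sum_lt => [|l _ _]; first exact: mulr_gt0.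
apply: small; apply: contra n_ij => /eqP[li lj].
by rewrite -li -lj subnKC // -ltnS.
Qed.

Lemma dominant_XsubC x : abs x != 1 -> exists i, dominant ('X - x%:P) i.
Proof.
have E j : ('X - x%:P)`_j = (j == 1%N)%:R - (if j == 0%N then x else 0).
  by rewrite coefB coefX coefC.
case: (ltgtP (abs x) 1) => // h _.
  exists 1%N => j j1; rewrite !E (negPf j1) /= subr0 abs1 sub0r absN.
  by case: ifP; rewrite ?abs0.
exists 0%N => j j0; rewrite !E (negPf j0) /= sub0r subr0 absN.
by case: eqP => _; rewrite ?abs1 // abs0 (lt_trans ltr01).
Qed.

(** Each linear factor [X - x] has a dominant coefficient because [|x|] is not 1, and dominance
    passes to products. *)
Lemma exists_dominant (q : {poly K}) : q != 0 ->
  (forall x, root q x -> abs x != 1) -> exists i, dominant q i.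
Proof.
have [rs ->] := closed_field_poly_normal q.
rewrite scaler_eq0 negb_or => /andP[c0 _] no_root.
have {no_root} : forall x, x \in rs -> abs x != 1.
  by move=> x xrs; apply: no_root; rewrite rootZ // root_prod_XsubC.
have [i qi] : exists i, dominant (lead_coef q)%:P i.
  exists 0%N => i; rewrite !coefC eqxx => /negPf->.
  by rewrite abs0 lt_neqAle eq_sym abs_eq0 c0 abs_ge0.
rewrite -mul_polyC; elim: rs _%:P i qi => [|x rs IH] s i si rs1.
  by exists i; rewrite big_nil mulr1.
have [j xj] := dominant_XsubC (rs1 x (mem_head _ _)).
rewrite big_cons mulrA; apply: IH (dominantM si xj) _ => y y_rs.
by apply: rs1; rewrite in_cons y_rs orbT.
Qed.

(** Kronecker substitution: a root of absolute value 1 of the resulting polynomial [q] would give a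
    zero of [f] on the torus, so [q] has a dominant coefficient. The codes being distinct, the
    coefficients of [q] are those of [f]. *)
Lemma nonvanishing_dominant d (f : laurent d) :
  (forall z : 'I_d -> K, in_Tp abs z -> leval f z != 0) ->
  exists2 nu0, nu0 \in finsupp f & forall nu, nu \in finsupp f -> nu != nu0 ->
    abs (f nu)%:~R < abs (f nu0)%:~R.
Proof.
(* [C] bounds every exponent in absolute value; shifted by [C], the exponents become digits between
   0 and [2 C], whence the base [B = 2 C + 1]. *)
move=> f_neq0; pose C := (\sum_(nu <- finsupp f) \sum_(i < d) `|nu ord0 i|)%N.
have leC nu i : nu \in finsupp f -> (`|nu ord0 i| <= C)%N.
  move=> nuf; rewrite /C (big_rem nu) //= (bigD1 i) //= -addnA; exact: leq_addr.
pose digit (nu : Zd d) i := absz (nu ord0 i + C%:Z).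
have digitE nu i : nu \in finsupp f -> (digit nu i : int) = nu ord0 i + C%:Z.
  by move=> nuf; have := leC nu i nuf; rewrite /digit; move: (nu ord0 i) (C); lia.
pose B := (2 * C).+1.
have digit_lt nu i : nu \in finsupp f -> (digit nu i < B)%N.
  by move=> nuf; have := leC nu i nuf; rewrite /digit /B; move: (nu ord0 i) (C); lia.
pose code nu := (\sum_i digit nu i * B ^ i)%N.
have code_inj : {in finsupp f &, injective code}.
  move=> nu mu nuf muf /base_expansion_inj E; apply/rowP => i.
  have := E (fun i => digit_lt nu i nuf) (fun i => digit_lt mu i muf) i.
  by move=> /(congr1 Posz); rewrite !digitE // => /addIr.
pose q : {poly K} := \sum_(nu <- finsupp f) (f nu)%:~R *: 'X^(code nu).
have q_code nu : nu \in finsupp f -> q`_(code nu) = (f nu)%:~R.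
  move=> nuf; rewrite /q coef_sum (big_rem nu) //= coefZ coefXn eqxx mulr1.
  rewrite big_seq big1 ?addr0 // => mu; rewrite mem_rem_uniq ?fset_uniq // inE => /andP[mu_nu muf].
  by rewrite coefZ coefXn (inj_in_eq code_inj) // eq_sym (negPf mu_nu) mulr0.
have q_other j : q`_j != 0 -> exists2 nu, nu \in finsupp f & j = code nu.
  move=> qj; have [/mapP[nu nuf ->]|nj] := boolP (j \in [seq code nu | nu <- finsupp f]).
    by exists nu.
  case/eqP: qj; rewrite /q coef_sum big_seq big1 // => nu nuf.
  rewrite coefZ coefXn; case: eqP => [jE|_]; last by rewrite mulr0.
  by rewrite jE map_f in nj.
(* Otherwise all coefficients of [f] vanish in [K], and [f] vanishes at [(1, ..., 1)]. *)
have q0 : q != 0.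
  have Tp1 : in_Tp abs (fun _ : 'I_d => 1) by move=> i; exact: abs1.
  apply: contra (f_neq0 _ Tp1) => /eqP q0.
  rewrite /leval big_seq big1 // => nu nuf.
  by rewrite -q_code // q0 coef0 mul0r.
have [x qx|i qi] := exists_dominant q0.
  apply/eqP => x1; have x0 : x != 0 by rewrite -abs_eq0 x1 oner_eq0.
  have Tpx : in_Tp abs (fun i : 'I_d => x ^+ (B ^ i)) by move=> i; rewrite absX x1 expr1n.
  move: (f_neq0 _ Tpx); rewrite -(mulrI_eq0 _ (mulfI (expf_neq0 (\sum_(i < d) C * B ^ i)%N x0))).
  (* The power of [x] in front compensates for the shift of every exponent by [C]. *)
  suff <- : q.[x] = x ^+ (\sum_(i < d) C * B ^ i)%N * leval f (fun i : 'I_d => x ^+ (B ^ i)).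
    by rewrite (rootP qx) eqxx.
  rewrite /q /leval horner_sum mulr_sumr big_seq [RHS]big_seq; apply: eq_bigr => nu nuf.
  rewrite hornerZ hornerXn mulrCA; congr (_ * _).
  rewrite /code !expr_sum -big_split; apply: eq_bigr => i _ /=.
  rewrite mulnC exprM (mulnC C) exprM (exprnP _ (digit nu i)) digitE //.
  by rewrite expfzDr ?expf_neq0 // mulrC.
have /q_other[nu0 nu0f iE] : q`_i != 0 by rewrite -abs_eq0 gt_eqF // dominant_gt0.
exists nu0 => // nu nuf nu_nu0; rewrite -!q_code // -iE; apply: qi.
by rewrite iE (inj_in_eq code_inj).
Qed.

(** * A growth estimate for the terms of the logarithm series *)

(** With [s] the square root of [rho] and [s^-1 = 1 + delta], Bernoulli's inequality gives
    [n delta s^n < 1]; squaring yields [n rho^n < 1 / (n delta^2)] for positive [n]. *)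
Lemma mul_geometric_small (rho : R) : 0 <= rho < 1 ->
  forall eps : R, 0 < eps -> exists M, forall n, (M <= n)%N -> n%:R * rho ^+ n < eps.
Proof.
move=> /andP[rho0 rho1] eps eps0.
have [->|rho_neq0] := eqVneq rho 0.
  by exists 1%N => -[|n] // _; rewrite exprS mul0r mulr0.
pose s := Num.sqrt rho.
have s2 : s ^+ 2 = rho by rewrite sqr_sqrtr.
have s0 : 0 < s by rewrite sqrtr_gt0 lt_neqAle eq_sym rho_neq0.
have s1 : s < 1 by rewrite -(@ltr_pXn2r R 2) ?nnegrE ?ltW // s2 expr1n.
pose delta := s^-1 - 1.
have delta0 : 0 < delta by rewrite subr_gt0 invf_gt1.
have bernoulli n : 1 + n%:R * delta <= s ^- n.
  rewrite -exprVn (_ : s^-1 = 1 + delta); last by rewrite addrC subrK.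
  elim: n => [|n IH]; first by rewrite mul0r addr0 expr0.
  rewrite exprS; apply: le_trans (ler_wpM2l _ IH); last by rewrite addr_ge0 ?ler01 ?ltW.
  have : 0 <= n%:R * (delta * delta) by rewrite !mulr_ge0 ?ler0n ?ltW.
  rewrite -natr1; lra.
have bound n : n%:R * delta * s ^+ n < 1.
  have sn : 0 < s ^+ n by rewrite exprn_gt0.
  rewrite -ltr_pdivlMr // mul1r; apply: lt_le_trans (bernoulli n); lra.
pose M := Num.bound (delta ^- 2 * eps^-1).
exists M.+1 => n lt_Mn; have n_gt0 : 0 < n%:R :> R by rewrite ltr0n (leq_ltn_trans _ lt_Mn).
have n_large : delta ^- 2 * eps^-1 < n%:R.
  apply: lt_trans (_ : M%:R < _); last by rewrite ltr_nat.
  by apply: archi_boundP; rewrite mulr_ge0 ?invr_ge0 ?exprn_ge0 ?ltW.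
have d2 : 0 < delta ^+ 2 by rewrite exprn_gt0.
have h : n%:R * delta * s ^+ n * (n%:R * delta * s ^+ n) < 1.
  have b0 : 0 <= n%:R * delta * s ^+ n by rewrite !mulr_ge0 ?ler0n ?exprn_ge0 ?ltW.
  by apply: mulr_ilt1.
rewrite -s2 -exprM mulnC exprM expr2.
rewrite -(ltr_pM2l d2) -(ltr_pM2l n_gt0).
apply: (@lt_trans _ _ 1).
  by apply: le_lt_trans h; rewrite le_eqVlt -subr_eq0; apply/orP; left; apply/eqP; ring.
by rewrite -ltr_pdivrMr ?mulr_gt0 // div1r invfM.
Qed.

(** * Algebraic properties of the p-adic logarithm *)

Context (logp : K -> K) (logp_log : is_logp p abs logp).

Lemma logpM x y : x != 0 -> y != 0 -> logp (x * y) = logp x + logp y.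
Proof. by case: logp_log => h _ _; exact: h. Qed.

Lemma logp1 : logp 1 = 0.
Proof.
have := logpM (oner_neq0 K) (oner_neq0 K); rewrite mulr1 => /eqP.
by rewrite -subr_eq subrr eq_sym => /eqP.
Qed.

Lemma logpX x n : x != 0 -> logp (x ^+ n) = logp x *+ n.
Proof.
move=> x0; elim: n => [|n IHn]; first by rewrite expr0 logp1.
by rewrite exprS logpM ?expf_neq0 // IHn mulrS.
Qed.

Lemma logp_unity_root x n : (0 < n)%N -> x ^+ n = 1 -> logp x = 0.
Proof.
move=> n_gt0 xn; have x0 : x != 0.
  by apply: contra_eq_neq xn => ->; rewrite expr0n gtn_eqF // eq_sym oner_eq0.
have /eqP := logpX n x0; rewrite xn logp1 eq_sym -mulr_natr mulf_eq0.
by rewrite (negPf (natr_abs_neq0 n_gt0)) orbF => /eqP.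
Qed.

Lemma logpN x : x != 0 -> logp (- x) = logp x.
Proof.
move=> x0; rewrite -mulN1r logpM ?oppr_eq0 ?oner_eq0 //.
by rewrite (@logp_unity_root (-1) 2) ?add0r // sqrrN expr1n.
Qed.

Lemma logp_prod (I : eqType) (r : seq I) (F : I -> K) :
  (forall i, F i != 0) -> logp (\prod_(i <- r) F i) = \sum_(i <- r) logp (F i).
Proof.
move=> F0; elim: r => [|i r IH]; first by rewrite !big_nil logp1.
by rewrite !big_cons logpM ?IH // prodf_seq_neq0; apply/allP => j _; exact: F0.
Qed.

(** * Averages of [log (1 + H)] for [H] with small coefficients *)

Section Moments.
Context (d : nat) (I : finType) (s : I -> Zd d) (h : I -> K) (rho : R).
Hypotheses (rho01 : 0 <= rho < 1) (h_rho : forall i, abs (h i) <= rho).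

Let H (z : 'I_d -> K) := \sum_i h i * monom (s i) z.

(** The sum of the coefficients of [H^n] at exponents in [G], expanded over words of length [n]
    without collecting equal monomials. For [G = {0}] it is the constant coefficient. *)
Definition moment (G : set (Zd d)) n : K :=
  \sum_(phi : {ffun 'I_n -> I} | `[< G (\sum_l s (phi l)) >]) \prod_l h (phi l).

Lemma moment_le G n : abs (moment G n) <= rho ^+ n.
Proof.
have /andP[rho0 _] := rho01.
apply: abs_sum_le => [|phi _ _]; first exact: exprn_ge0.
rewrite abs_prod -[in leRHS](card_ord n) -prodr_const.
by apply: ler_prod => l _; rewrite abs_ge0 h_rho.
Qed.

Lemma monom_abs1 nu (z : 'I_d -> K) : in_Tp abs z -> abs (monom nu z) = 1.
Proof. by move=> z1; rewrite /monom abs_prod big1 // => i _; rewrite abs_exprz. Qed.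

Lemma monomD nu mu (z : 'I_d -> K) : in_Tp abs z ->
  monom (nu + mu) z = monom nu z * monom mu z.
Proof.
move=> z1; rewrite /monom -big_split; apply: eq_bigr => i _.
by rewrite mxE expfzDr // -abs_eq0 z1 oner_eq0.
Qed.

Lemma monom0 (z : 'I_d -> K) : monom 0 z = 1.
Proof. by rewrite /monom big1 // => i _; rewrite mxE expr0z. Qed.

Lemma abs_H z : in_Tp abs z -> abs (H z) < 1.
Proof.
have /andP[rho0 rho1] := rho01; move=> z1; apply: le_lt_trans rho1.
by apply: abs_sum_le => // i _ _; rewrite absM monom_abs1 // mulr1.
Qed.

Lemma H_exp z n : in_Tp abs z ->
  H z ^+ n = \sum_(phi : {ffun 'I_n -> I})
    (\prod_l h (phi l)) * monom (\sum_l s (phi l)) z.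
Proof.
move=> z1; rewrite -[in LHS](card_ord n) -prodr_const.
rewrite (eq_bigl xpredT) // bigA_distr_bigA; apply: eq_bigr => phi _.
rewrite big_split; congr (_ * _).
by rewrite (big_morph (fun nu => monom nu z) (fun nu mu => monomD nu mu z1) (monom0 z)).
Qed.

(** Discrete orthogonality: averaging over the points [z j] turns a Laurent polynomial into the sum
    of its coefficients over [G]. *)
Definition quadrature (J : finType) (z : J -> 'I_d -> K) (G : set (Zd d)) :=
  forall nu, \sum_j monom nu (z j) = if `[< G nu >] then #|J|%:R else 0.

Lemma sum_H_exp (J : finType) (z : J -> 'I_d -> K) G n :
  (forall j, in_Tp abs (z j)) -> quadrature z G ->
  \sum_j H (z j) ^+ n = #|J|%:R * moment G n.
Proof.
move=> z1 zG; under eq_bigr do rewrite H_exp //.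
rewrite exchange_big /= /moment [in RHS]big_mkcond mulr_sumr; apply: eq_bigr => phi _.
rewrite -mulr_sumr zG; case: ifP => _; rewrite ?mulr0 //; exact: mulrC.
Qed.

Definition log_moment G n : K :=
  \sum_(1 <= i < n.+1) (-1) ^+ i.+1 * moment G i / i%:R.

Definition log_partial x n : K :=
  \sum_(1 <= i < n.+1) (-1) ^+ i.+1 * x ^+ i / i%:R.

Lemma sum_log_partial (J : finType) (z : J -> 'I_d -> K) G n :
  (forall j, in_Tp abs (z j)) -> quadrature z G ->
  \sum_j log_partial (H (z j)) n = #|J|%:R * log_moment G n.
Proof.
move=> z1 zG; rewrite /log_partial exchange_big /log_moment mulr_sumr /=.
apply: eq_bigr => i _.
by rewrite -mulr_suml -mulr_sumr (sum_H_exp _ z1 zG) mulrCA !mulrA.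
Qed.

Lemma abs_log_term i x : abs x <= rho ^+ i ->
  abs ((-1) ^+ i.+1 * x / i%:R) <= i%:R * rho ^+ i.
Proof.
move=> xi; rewrite !absM absX absN abs1 expr1n mul1r mulrC.
by apply: ler_pM; rewrite ?abs_ge0 ?abs_natV.
Qed.

(** The terms are at most [i rho^i], which tends to 0, and an ultrametric sum is no larger than its
    largest term. *)
Lemma log_moment_cvg G : exists l, abs_converges abs (log_moment G) l.
Proof.
have [_ [_ [_ [_ [complete _]]]]] := Cp; apply: complete => eps eps0.
have [M MP] := mul_geometric_small rho01 eps0; exists M.
suff cauchy m n : (M <= m)%N -> (m <= n)%N -> abs (log_moment G n - log_moment G m) < eps.
  move=> m n Mm Mn; case: (leqP n m) => [|/ltnW] mn; first exact: cauchy.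
  by rewrite -absN opprB; exact: cauchy.
move=> Mm mn; rewrite /log_moment (@big_cat_nat _ _ _ m.+1 1 n.+1) //=.
rewrite addrAC subrr add0r big_nat; apply: abs_sum_lt => // i _ /andP[mi _].
apply: le_lt_trans (MP i _); last by rewrite (leq_trans Mm) // ltnW.
by apply: abs_log_term; exact: moment_le.
Qed.

(** [L] collects the nonzero exponents of the expansions of [H^i] for [i < M]. If [G] avoids them,
    the moments below [M] agree exactly, and the terms from [M] on are small. The bound is uniform
    in [n]. *)
Lemma log_moment_approx (eps : R) : 0 < eps -> exists2 L : seq (Zd d),
  (forall nu, nu \in L -> nu != 0) &
  forall G, G 0 -> (forall nu, nu \in L -> ~ G nu) ->
    forall n, abs (log_moment G n - log_moment [set 0] n) < eps.
Proof.
move=> eps0; have [M MP] := mul_geometric_small rho01 eps0.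
pose L := flatten [seq [seq \sum_l s (phi l) | phi : {ffun 'I_i -> I}] | i <- iota 0 M].
exists [seq nu <- L | nu != 0]; first by move=> nu; rewrite mem_filter => /andP[].
move=> G G0 GL n; rewrite /log_moment -sumrB; apply: abs_sum_lt => // i _ _.
rewrite -mulrBl -mulrBr; have [Mi|iM] := leqP M i.
  apply: le_lt_trans (MP i Mi); apply: abs_log_term.
  apply: le_trans (absD_le _ _) _; rewrite ge_max absN; apply/andP.
  by split; exact: moment_le.
suff -> : moment G i = moment [set 0] i by rewrite subrr mulr0 mul0r abs0.
apply: eq_bigl => phi; apply/asboolP/asboolP => /= [Gphi|-> //].
apply: contrapT => /eqP phi0; apply: GL Gphi.
rewrite mem_filter phi0; apply/flattenP; exists [seq \sum_l s (phi l) | phi : {ffun 'I_i -> I}].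
  by apply/mapP; exists i; rewrite ?mem_iota.
by apply/mapP; exists phi; rewrite ?mem_enum.
Qed.

(** The limit is that of [log_moment [set 0]]. The error has three parts: truncation of the
    logarithms, replacement of [G] by [{0}], and the tail of the limit series. *)
Lemma log1p_average_cvg : exists l : K, forall eps : R, 0 < eps ->
  exists2 L : seq (Zd d), (forall nu, nu \in L -> nu != 0) &
  forall (J : finType) (z : J -> 'I_d -> K) (G : set (Zd d)),
    (0 < #|J|)%N -> (forall j, in_Tp abs (z j)) -> quadrature z G ->
    G 0 -> (forall nu, nu \in L -> ~ G nu) ->
    abs (#|J|%:R^-1 * (\sum_j logp (1 + H (z j))) - l) < eps.
Proof.
have [l u_l] := log_moment_cvg [set 0]; exists l => eps eps0.
have [L L0 LP] := log_moment_approx eps0; exists L => // J z G J_gt0 z1 zG G0 GL.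
have cJ0 := natr_abs_neq0 J_gt0; set c : K := #|J|%:R in cJ0 *.
have c_gt0 : 0 < abs c by rewrite lt_neqAle eq_sym abs_eq0 cJ0 abs_ge0.
(* Dividing by [#|J|] may enlarge the absolute value, so the truncation error is first made smaller
   than [eps] times [abs c]. *)
have e0 : 0 < eps * abs c by rewrite mulr_gt0.
have /choice[N NP] j : exists N, forall n, (N <= n)%N ->
    abs (log_partial (H (z j)) n - logp (1 + H (z j))) < eps * abs c.
  case: logp_log => _ _ /(_ (1 + H (z j))); rewrite addrAC subrr add0r.
  by move=> /(_ (abs_H (z1 j))) /(_ _ e0).
have [M MP] := u_l _ eps0.
(* This [n] depends on the points [z j], while [L] does not; the uniformity in [n] of
   [log_moment_approx] permits this. *)
pose n := maxn M (\max_j N j).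
have h1 : abs (c^-1 * \sum_j (logp (1 + H (z j)) - log_partial (H (z j)) n)) < eps.
  rewrite absM absV mulrC ltr_pdivrMr //; apply: abs_sum_lt => // j _ _.
  by rewrite -absN opprB; apply: NP; rewrite leq_max (leq_bigmax j) orbT.
have h2 := LP G G0 GL n.
have h3 : abs (log_moment [set 0] n - l) < eps by apply: MP; exact: leq_maxl.
move: h1; rewrite sumrB (sum_log_partial _ z1 zG) mulrBr mulKf // => h1.
by have := absD_lt (absD_lt h1 h2) h3; rewrite !addrA !subrK.
Qed.

End Moments.

(** * Averages of [log_p f] over torsion points *)

(** After factoring out the dominant term [b t^nu0], the constant contributes [logp b], the monomial
    contributes 0 at torsion points, and [1 + H] falls under [log1p_average_cvg]. *)
Lemma log_average_cvg d (f : laurent d) :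
  (forall z : 'I_d -> K, in_Tp abs z -> leval f z != 0) ->
  exists l : K, forall eps : R, 0 < eps ->
  exists2 L : seq (Zd d), (forall nu, nu \in L -> nu != 0) &
  forall (J : finType) (z : J -> 'I_d -> K) (G : set (Zd d)),
    (0 < #|J|)%N -> (forall j i, exists2 m, (0 < m)%N & z j i ^+ m = 1) ->
    quadrature z G -> G 0 -> (forall nu, nu \in L -> ~ G nu) ->
    abs (#|J|%:R^-1 * (\sum_j logp (leval f (z j))) - l) < eps.
Proof.
move=> f_neq0; have [nu0 nu0f dom] := nonvanishing_dominant f_neq0.
set b : K := (f nu0)%:~R in dom.
pose S := rem nu0 (finsupp f).
have SP nu : nu \in S -> abs ((f nu)%:~R) < abs b.
  by rewrite mem_rem_uniq ?fset_uniq // inE => /andP[? ?]; apply: dom.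
pose I := 'I_(size S); pose s (i : I) := tnth (in_tuple S) i - nu0.
pose h (i : I) : K := (f (tnth (in_tuple S) i))%:~R / b.
(* The default 0 is the value when [f] has a single term and [H = 0]. *)
pose rho : R := \big[Num.max/0]_(i : I) abs (h i).
have [b0|b_neq0] := eqVneq b 0.
  have Tp1 : in_Tp abs (fun _ : 'I_d => 1) by move=> i; exact: abs1.
  case/eqP: (f_neq0 _ Tp1); rewrite /leval big_seq big1 // => nu nuf.
  have [->|/(dom _ nuf)] := eqVneq nu nu0; first by rewrite -/b b0 mul0r.
  by rewrite b0 abs0 ltNge abs_ge0.
have b_gt0 : 0 < abs b by rewrite lt_neqAle eq_sym abs_eq0 b_neq0 abs_ge0.
have rho01 : 0 <= rho < 1.
  apply/andP; split; first exact: bigmax_ge_id.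
  apply/bigmax_ltP; split=> // i _; rewrite absM absV ltr_pdivrMr // mul1r.
  by apply: SP; exact: mem_tnth.
have h_rho i : abs (h i) <= rho by apply: le_bigmax.
have [l lP] := log1p_average_cvg s rho01 h_rho.
exists (logp b + l) => eps /lP[L L0 LP]; exists L => // J z G J_gt0 z_root zG G0 GL.
have z1 j : in_Tp abs (z j).
  by move=> i; have [m m_gt0] := z_root j i; exact: abs_unity_root.
have log_monom j nu : logp (monom nu (z j)) = 0.
  have z0 i : z j i ^ nu ord0 i != 0 by rewrite -abs_eq0 (abs_exprz _ (z1 j i)) oner_eq0.
  rewrite /monom logp_prod // big1 // => i _.
  have [m m_gt0 zm] := z_root j i; apply: (@logp_unity_root _ m) => //.
  by rewrite exprnP exprz_exp mulrC -exprz_exp -exprnP zm exp1rz.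
have levalE j : leval f (z j) = b * monom nu0 (z j) * (1 + \sum_i h i * monom (s i) (z j)).
  rewrite /leval (big_rem nu0) //= -/b -/S mulrDr mulr1 mulr_sumr.
  congr (_ + _); rewrite big_tnth; apply: eq_bigr => i _.
  rewrite -/(monom _ _) /h /s mulrACA -monomD // [nu0 + _]addrC subrK.
  by rewrite [b * _]mulrC divfK.
have logE j : logp (leval f (z j)) = logp b + logp (1 + \sum_i h i * monom (s i) (z j)).
  have := f_neq0 _ (z1 j); rewrite levalE !mulf_eq0 !negb_or -andbA => /and3P[? ? ?].
  by rewrite !logpM ?mulf_neq0 // log_monom addr0.
under eq_bigr do rewrite logE.
rewrite big_split /= sumr_const -[logp b *+ _]mulr_natl mulrDr mulKf ?natr_abs_neq0 //.
by rewrite opprD addrACA subrr add0r; apply: LP GL.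
Qed.

End Ultrametric.

(** * Roots of unity and their power sums *)

Section RootsOfUnity.
Context (K : closedFieldType) (N : nat).
Hypothesis N_neq0 : N%:R != 0 :> K.

Let N_gt0 : (0 < N)%N.
Proof. by case: (N) N_neq0 => //; rewrite eqxx. Qed.

Lemma mu_seqP : is_mu_seq N (mu_seq K N).
Proof.
rewrite /mu_seq; case: pselect => [h|[]]; first exact: (projT2 (cid h)).
have [rs rs_uniq rsE] := prod_root_unity N_neq0; exists rs; split=> // x.
by rewrite -root_prod_XsubC -rsE rootE !hornerE subr_eq0.
Qed.

Lemma size_mu_seq : size (mu_seq K N) = N.
Proof.
have [rs rs_uniq rsE] := prod_root_unity N_neq0.
have /(congr1 (size \o polyseq)) := rsE; rewrite /= size_XnsubC // size_prod_XsubC => -[NE].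
have [mu_uniq muE] := mu_seqP; rewrite [RHS]NE; apply: perm_size; apply: uniq_perm => // x.
by rewrite muE -root_prod_XsubC -rsE rootE !hornerE subr_eq0.
Qed.

Lemma card_mu_seq_torus d :
  #|{ffun 'I_d -> 'I_(size (mu_seq K N))}| = (N ^ d)%N.
Proof. by rewrite card_ffun !card_ord size_mu_seq. Qed.

(** Multiplication by a primitive root [w] permutes the roots of unity, so the sum [S] satisfies
    [S = w^a S]; if [N] does not divide [a], then [w^a] is not 1 and [S = 0]. *)
Lemma sum_mu_seq_exprz (a : int) :
  \sum_(x <- mu_seq K N) x ^ a = if (N %| a)%Z then N%:R else 0.
Proof.
have [mu_uniq muE] := mu_seqP.
case: ifP => [/dvdzP[q ->]|/negP Na].
  rewrite big_seq (eq_bigr (fun _ => 1)) => [|x].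
    by rewrite -big_seq big_const_seq count_predT iter_addr_0 size_mu_seq.
  by rewrite muE mulrC -exprz_exp -exprnP => /eqP->; rewrite exp1rz.
have /hasP[w w_mu w_prim] : has N.-primitive_root (mu_seq K N).
  apply: cyclic.has_prim_root; rewrite ?size_mu_seq //.
  by apply/allP => x; rewrite muE => xN; apply/unity_rootP/eqP.
have wN := prim_expr_order w_prim.
have w0 : w != 0 by apply: contra_eq_neq wN => ->; rewrite expr0n gtn_eqF // eq_sym oner_eq0.
have w_mu_perm : perm_eq [seq w * x | x <- mu_seq K N] (mu_seq K N).
  have inj : injective ( *%R w) by exact: mulfI.
  apply: uniq_perm; rewrite ?map_inj_uniq // => x; apply/mapP/idP => [[y]|].
    by rewrite !muE => /eqP yN ->; rewrite exprMn wN yN mulr1.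
  move=> x_mu; exists (w^-1 * x); last by rewrite mulVKf.
  by move: x_mu; rewrite !muE => /eqP xN; rewrite exprMn exprVn wN xN invr1 mulr1.
set S := \sum_(x <- _) _.
have wS : S = w ^ a * S.
  rewrite {1}/S -(perm_big _ w_mu_perm) big_map mulr_sumr /=.
  by apply: eq_bigr => x _; exact: expfzMl.
have wa : w ^ a != 1.
  apply/negP => /eqP wa1; apply: Na.
  have r0 : 0 <= (a %% N)%Z by rewrite modz_ge0 // eqz_nat -lt0n.
  have := wa1; rewrite {1}(divz_eq a N) expfzDr // mulrC mulrC.
  rewrite [_ * N%:Z]mulrC -exprz_exp -exprnP wN exp1rz mul1r.
  rewrite -[(a %% N)%Z]gez0_abs // -exprnP => /eqP.
  rewrite -(prim_order_dvd w_prim) => /dvdn_leq h.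
  apply/dvdz_mod0P; apply/eqP; rewrite -absz_eq0 -leqn0 leqNgt; apply/negP => /h.
  have := @ltz_pmod a N; lia.
apply/eqP; move/eqP: wS; rewrite -subr_eq0 -{1}[S]mul1r -mulrBl mulf_eq0.
by rewrite subr_eq0 eq_sym (negPf wa).
Qed.

End RootsOfUnity.

(** * Quadratures from roots of unity and from finite quotients *)

Section Assembly.
Context (p : nat) (K : closedFieldType) (R : realType) (abs : K -> R).
Hypotheses (p_prime : prime p) (Cp : is_Cp p abs).

Let char0 n : (0 < n)%N -> n%:R != 0 :> K := @natr_abs_neq0 p K R abs p_prime Cp n.

Lemma mu_seq_quadrature d N : (0 < N)%N ->
  quadrature (fun (k : {ffun 'I_d -> 'I_(size (mu_seq K N))}) i =>
      nth 0 (mu_seq K N) (k i))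
    [set nu : Zd d | forall i, (N %| nu ord0 i)%Z].
Proof.
move=> /char0 N0 nu; rewrite card_mu_seq_torus // natrX.
transitivity (\prod_(i < d) (if (N %| nu ord0 i)%Z then N%:R else 0 : K)).
  (* The sum over the grid of [N]-th roots factors into one power sum per coordinate. *)
  under [RHS]eq_bigr do rewrite -sum_mu_seq_exprz // (big_nth 0) big_mkord.
  by rewrite bigA_distr_bigA.
case: asboolP => [Nnu|/existsNP[i /negP/negPf Ni]].
  rewrite (eq_bigr (fun _ => N%:R)) => [|i _]; last by rewrite Nnu.
  by rewrite prodr_const card_ord.
by rewrite (bigD1 i) //= Ni mul0r.
Qed.

Lemma eventually_avoids d (G : nat -> set (Zd d)) (L : seq (Zd d)) :
  tends_to_zero G -> (forall nu, nu \in L -> nu != 0) ->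
  exists M, forall n, (M <= n)%N -> forall nu, nu \in L -> ~ G n nu.
Proof.
move=> [_ G_lim]; elim: L => [|mu L IH] L0; first by exists 0%N.
have [M MP] : exists M, forall n, (M <= n)%N -> forall nu, nu \in L -> ~ G n nu.
  by apply: IH => nu nuL; apply: L0; rewrite in_cons nuL orbT.
have [M' M'P] := G_lim mu (L0 _ (mem_head _ _)); exists (maxn M M') => n.
rewrite geq_max => /andP[Mn M'n] nu; rewrite in_cons => /orP[/eqP->|]; first exact: M'P.
exact: MP.
Qed.

(** The product is the image in [K] of an integer determinant, nonzero because [f] does not vanish
    at torsion points. The count is its absolute value, hence the ambiguity of sign, which [logp]
    does not see. *)
Lemma card_Fix_characters d (f : laurent d) (G : set (Zd d)) k :
  (forall z : 'I_d -> K, in_Tp abs z -> leval f z != 0) ->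
  is_subgroup G -> has_index G k ->
  exists c (z : 'I_k -> 'I_d -> K),
    [/\ (0 < k)%N, has_card (Fix_N G (X_f R f)) c,
        forall j i, exists2 m, (0 < m)%N & z j i ^+ m = 1, quadrature z G
      & \prod_j leval f (z j) = c%:R \/ \prod_j leval f (z j) = - c%:R].
Proof.
move=> f_neq0 G_sub G_ind; have [r [cl [k_gt0 clK clP]]] := index_class G_sub G_ind.
have [z [z_root zG z_det]] := quotient_characters clK clP char0 k_gt0.
have detE : \prod_j leval f (z j) = (\det (convmx r cl int f))%:~R.
  by rewrite -z_det convmx_int det_map_mx.
exists `|\det (convmx r cl int f)|%N, z; split=> //.
- apply: has_card_Fix => //; apply/eqP => det0; move/eqP: detE; rewrite det0.
  apply/negP/prodf_neq0 => j _; apply: f_neq0 => i.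
  by have [m m_gt0] := z_root j i; exact: (abs_unity_root Cp).
- by move=> nu; rewrite zG card_ord.
by rewrite detE; case: (\det _) => n; [left|right].
Qed.

End Assembly.

Theorem theorem1p7 (p d : nat) (K : closedFieldType) (R : realType)
  (abs : K -> R) (logp : K -> K) (f : laurent d) :
  prime p -> (0 < d)%N ->
  is_Cp p abs -> is_logp p abs logp ->
  (forall z : 'I_d -> K, in_Tp abs z -> leval f z != 0) ->
  forall G : nat -> set (Zd d), tends_to_zero G ->
  exists l : K,
    (* m_p(f) = int_{T_p^d} log_p f(z) exists and equals l *)
    snirelman_integral_is p abs (fun z => logp (leval f z)) l /\
    (* the fixed point sets are finite *)
    (forall n, exists c, has_card (Fix_N (G n) (X_f R f)) c) /\
    (* and h_p(f) = lim (Gamma:Gamma_n)^{-1} log_p |Fix_{Gamma_n}(X_f)| = l *)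
    (forall k c : nat -> nat,
       (forall n, has_index (G n) (k n)) ->
       (forall n, has_card (Fix_N (G n) (X_f R f)) (c n)) ->
       abs_converges abs (fun n => (k n)%:R^-1 * logp (c n)%:R) l).
Proof.
move=> p_prime _ Cp logp_log f_neq0 G G_lim; have [G_sub _] := G_lim.
have [l lP] := log_average_cvg p_prime Cp logp_log f_neq0.
exists l; split; [|split].
- move=> eps /lP[L L0 LP].
  (* Such an [N] exceeds all coordinates of the vectors in [L] in absolute value, so it can divide
     all coordinates of one of them only if that vector is 0. *)
  exists (\sum_(nu <- L) \sum_(i < d) `|nu ord0 i|).+1%N => N lt_LN _.
  have N_gt0 := leq_ltn_trans (leq0n _) lt_LN.
  have N0 := natr_abs_neq0 p_prime Cp N_gt0.
  have [mu_uniq muE] := mu_seqP N0.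
  have := LP _ _ _ _ _ (mu_seq_quadrature p_prime Cp N_gt0).
  rewrite (card_mu_seq_torus N0) natrX; apply; first by rewrite expn_gt0 N_gt0.
  + move=> k i; exists N => //; apply/eqP; rewrite -muE; exact: mem_nth.
  + by move=> i; rewrite mxE dvdz0.
  move=> nu nuL /= Nnu; case/eqP: (L0 nu nuL); apply/rowP => i; rewrite mxE.
  have := Nnu i; rewrite dvdzE /= => /dvdn_leq; rewrite lt0n absz_eq0.
  case: eqP => // _ /(_ isT); rewrite leqNgt (leq_trans _ lt_LN) // ltnS.
  by rewrite (big_rem nu) //= (bigD1 i) //= -addnA leq_addr.
- move=> n; have [G_n [k Gk]] := G_sub n.
  by have [c [z [_ ? _ _ _]]] := card_Fix_characters p_prime Cp f_neq0 G_n Gk; exists c.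
move=> k c Gk Gc eps /lP[L L0 LP]; have [M MP] := eventually_avoids G_lim L0.
exists M => n /MP GL; have [G_n _] := G_sub n.
have [c' [z [k_gt0 Gc' z_root zG c'E]]] := card_Fix_characters p_prime Cp f_neq0 G_n (Gk n).
rewrite (has_card_uniq (Gc n) Gc').
have z_neq0 j : leval f (z j) != 0.
  by apply: f_neq0 => i; have [m m_gt0] := z_root j i; exact: (abs_unity_root Cp).
have prod0 : \prod_j leval f (z j) != 0 by apply/prodf_neq0.
have -> : logp c'%:R = \sum_j logp (leval f (z j)).
  rewrite -(logp_prod logp_log) //; case: c'E => E; rewrite E //.
  rewrite (logpN p_prime Cp logp_log) //.
  by rewrite -oppr_eq0 -E.
have := LP _ z (G n) _ z_root zG; rewrite card_ord; apply=> //.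
by case: G_n.
Qed.
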